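(* Let $I=[0,1]$, $\mathbb{R}^+=[0,\infty)$, and consider the system $$x_j(t)=\int_0^1G_j(t,s)f_j(s,x_1(s),x_2(s))\,ds,\quad t\in I,\quad j=1,2. \qquad (\ast)$$ Assume that for each $j\in\{1,2\}$: the kernel $G_j:I^2\to\mathbb{R}^+$ is continuous; there exist a closed interval $J\subset I$ (the same for $j=1,2$), a function $\Phi_j:I\to\mathbb{R}^+$ with $\Phi_j\in L^1(0,1)$ and $\int_J\Phi_j(s)\,ds>0$, and a constant $c_j\in(0,1)$ such that $G_j(t,s)\leq\Phi_j(s)$ for all $t,s\in I$ and $c_j\Phi_j(s)\leq G_j(t,s)$ for all $t\in J$, $s\in I$; and the function $f_j:I\times\mathbb{R}^+\times\mathbb{R}^+\to\mathbb{R}^+$ is continuous. Suppose that there exist $r_j,R_j,A_j,B_j\in(0,\infty)$, $j=1,2$, such that $r_j<c_jR_j$, $B_j\leq d_j\leq A_j$ and $B_jS_j+A_jS_j^c<1$. Assume further that, for each $j\in\{1,2\}$: (A) $0\leq M_j^{R}(s)\leq A_jR_j$ for $s\in J^c$ and $0\leq M_j^{r,R}(s)\leq B_jR_j$ for $s\in J$; (B) $m_j^{r,R}(s)>D_jr_j$ for $s\in J$. Then the system $(\ast)$ has at least one positive solution $(x_1,x_2)\in K$ such that $r_j<\min_{t\in J}x_j(t)$ and $\|x_j\|_\infty<R_j$ for $j=1,2$.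
   Context: Here $J^c=I\setminus J$, $\|x\|_\infty=\max_{t\in I}|x(t)|$, and $$d_j:=\left(\max_{t\in[0,1]}\int_0^1G_j(t,s)ds\right)^{-1},\qquad D_j:=\left(\min_{t\in J}\int_JG_j(t,s)ds\right)^{-1},$$ $$S_j:=\max_{t\in[0,1]}\int_JG_j(t,s)ds,\qquad S_j^c:=\max_{t\in[0,1]}\int_{J^c}G_j(t,s)ds.$$ The cone is $K=K_1\times K_2$ with $$K_j=\{x\in\mathcal{C}(I):x(t)\geq0\text{ for }t\in I,\ x(t)\geq c_j\|x\|_\infty\text{ for }t\in J\}.$$ For $s\in I$, $j\in\{1,2\}$ and $i\in\{1,2\}$, $i\neq j$: $$m_j^{r,R}(s):=\min\left\{f_j(s,x_1,x_2):r_j\leq x_j\leq\tfrac{r_j}{c_j},\ r_i\leq x_i\leq R_i\right\},$$ $$M_j^{R}(s):=\max\{f_j(s,x_1,x_2):0\leq x_j\leq R_j,\ 0\leq x_i\leq R_i\},$$ $$M_j^{r,R}(s):=\max\{f_j(s,x_1,x_2):c_jR_j\leq x_j\leq R_j,\ r_i\leq x_i\leq R_i\}.$$ A positive solution is a pair of nonnegative, not identically zero, continuous functions on $I$ satisfying the system. *)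

(* Defs.v *)
From HB Require Import structures.
From mathcomp Require Export all_boot all_order all_algebra.
From mathcomp Require Export all_classical all_reals all_analysis.
Export Order.TTheory GRing.Theory Num.Theory numFieldNormedType.Exports.

Set Implicit Arguments.
Unset Strict Implicit.
Unset Printing Implicit Defensive.

Local Open Scope classical_set_scope.
Local Open Scope ring_scope.

(* The subscripts 1, 2 of the system are the elements 0, 1 of 'I_2.
   Functions on I, I^2 and I x R^+ x R^+ are total functions on R, R^2, R^3 of
   which only the restriction to the relevant set is ever used.
   All maxima and minima below are taken of continuous functions over nonempty
   compact sets, so they are the sup/inf of the image. *)

Section System.
Context {R : realType}.
Implicit Types (J : set R) (j : 'I_2) (G : 'I_2 -> R -> R -> R).
Implicit Types (f : 'I_2 -> R -> R -> R -> R) (x : 'I_2 -> R -> R).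
Implicit Types (c r Rr : 'I_2 -> R).

Definition I01 : set R := `[0, 1]%classic.
Definition Rplus : set R := `[0, +oo[%classic.

Definition closed_subinterval J : Prop :=
  exists a b : R, [/\ 0 <= a, a <= b, b <= 1 & J = `[a, b]%classic].

Definition maxOn (A : set R) (u : R -> R) : R := sup (u @` A).
Definition minOn (A : set R) (u : R -> R) : R := inf (u @` A).

Definition normI (u : R -> R) : R := maxOn I01 (fun t => `|u t|).

Definition kint G j (A : set R) (t : R) : R :=
  \int[lebesgue_measure]_(s in A) G j t s.

Definition d_ G j : R := (maxOn I01 (kint G j I01))^-1.
Definition D_ G J j : R := (minOn J (kint G j J))^-1.
Definition S_ G J j : R := maxOn I01 (kint G j J).
Definition Sc_ G J j : R := maxOn I01 (kint G j (I01 `\` J)).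

Definition fval f j (s : R) (v : 'I_2 -> R) : R := f j s (v 0) (v 1).

Definition m_rR f c r Rr j (s : R) : R :=
  inf (fval f j s @` [set v | r j <= v j <= r j / c j /\
                              forall i, i != j -> r i <= v i <= Rr i]).

Definition M_R f Rr j (s : R) : R :=
  sup (fval f j s @` [set v | 0 <= v j <= Rr j /\
                              forall i, i != j -> 0 <= v i <= Rr i]).

Definition M_rR f c r Rr j (s : R) : R :=
  sup (fval f j s @` [set v | c j * Rr j <= v j <= Rr j /\
                              forall i, i != j -> r i <= v i <= Rr i]).

Definition coneK J (cj : R) : set (R -> R) :=
  [set u : R -> R | [/\ {within I01, continuous u},
                     forall t, I01 t -> 0 <= u t &
                     forall t, J t -> cj * normI u <= u t]].

Definition cone J c : set ('I_2 -> R -> R) :=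
  [set x | forall j, coneK J (c j) (x j)].

Definition solves G f x : Prop :=
  forall j t, I01 t ->
    x j t = \int[lebesgue_measure]_(s in I01) (G j t s * f j s (x 0 s) (x 1 s)).

Definition positive_solution G f x : Prop :=
  (forall j, [/\ {within I01, continuous (x j)},
                 forall t, I01 t -> 0 <= x j t &
                 exists2 t, I01 t & x j t != 0]) /\
  solves G f x.

(* Phi is only assumed Lebesgue (not Borel) measurable, hence the completed
   measure; the other integrands of this file are continuous. *)
Definition kernel_bound J (g : R -> R -> R) (Phi : R -> R) (cj : R) : Prop :=
  [/\ forall s, I01 s -> 0 <= Phi s,
      completed_lebesgue_measure.-integrable `]0, 1[ (EFin \o Phi),
      0 < \int[completed_lebesgue_measure]_(s in J) Phi s,
      forall t s, I01 t -> I01 s -> g t s <= Phi s &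
      forall t s, J t -> I01 s -> cj * Phi s <= g t s].

End System.

(* Main.v *)
Require Import Defs.
From mathcomp Require Import ring lra.
Set Implicit Arguments.
Unset Strict Implicit.
Unset Printing Implicit Defensive.
Local Open Scope classical_set_scope.
Local Open Scope ring_scope.

(** The bounds on the nonlinearity only concern arguments in certain boxes, so the
    integral operator is first composed with a truncation: each component is
    lifted by a constant so that it is at least r on J, then clipped to [0, R].
    The truncated nonlinearity is bounded and continuous for the uniform norm, so
    the truncated system has a solution z ([hammerstein_fixed_point]).  As an
    integral of a nonnegative function against the kernel, z is nonnegative and
    satisfies the Harnack inequality c z(t') <= z(t) for t in J ([z_harnack]).

    The hypotheses then show that the truncation is inactive on z.  If z_j reached
    R_j, the Harnack inequality would place the truncated component between
    c_j R_j and R_j on J; the bounds on the maxima of f_j and B S + A S^c < 1 would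
    give z_j < R_j everywhere ([z_lt_Rr]).  If the minimum of z_j on J were at most
    r_j, the truncated component would lie between r_j and r_j / c_j on J, and
    the bound on the minimum of f_j would give z_j > r_j on J ([r_lt_minOn_z]).  So z solves the
    original system and satisfies the strict bounds.

    The fixed point of the truncated system comes from finite dimensions.
    Replacing the integral by Riemann sums leaves a continuous self-map of a cube,
    which has approximate fixed points ([approx_brouwer]).  The resulting
    functions are equicontinuous and bounded, and any limit of them along an
    ultrafilter is a solution.  The finite-dimensional result rests on Kuhn's
    cubical form of Sperner's lemma ([kuhn_lemma]), proved by a Stokes formula
    with coefficients in the field with two elements. *)

(** * Kuhn's cubical lemma by counting modulo 2 *)

(** The carrier [bool], with its ring structure, is the field with two elements;
    there the two terms indexed by (d, e) and (e, d) cancel. *)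
Lemma sum_symmetric_offdiag (T : finType) (D : {set T}) (F : T -> T -> bool) :
  (forall d e, F d e = F e d) ->
  \sum_(d in D) \sum_(e in D :\ d) F d e = 0.
Proof.
move=> symF.
pose lt (d e : T) := (enum_rank d < enum_rank e)%N.
have -> : \sum_(d in D) \sum_(e in D :\ d) F d e =
    \sum_(d in D) \sum_(e in D) (F d e *+ lt d e + F d e *+ lt e d).
  apply: eq_bigr => d dD; rewrite (bigD1 d dD) /= /lt ltnn !mulr0n !add0r.
  apply: eq_big => e; first by rewrite in_setD1 andbC.
  move=> /setD1P[ed _]; case: ltngtP => [_|_|/val_inj/enum_rank_inj/esym/eqP].
  - by rewrite mulr0n addr0 mulr1n.
  - by rewrite mulr0n add0r mulr1n.
  - by rewrite (negPf ed).
under eq_bigr do rewrite big_split.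
rewrite big_split /= [X in _ + X]exchange_big /=.
rewrite -big_split /= big1 // => d _; rewrite -big_split /= big1 // => e _.
by rewrite symF; case: (_ *+ _).
Qed.

Section Kuhn.
Variables (T : finType) (p : nat).
Hypothesis p_gt0 : (0 < p)%N.
Let V := {ffun T -> 'I_p.+1}.
Variable U : T -> V -> bool.
Implicit Types (D : {set T}) (q : V) (ls : seq T).

(** At the top layer [inord] sends the shifted coordinate back to 0: the grid is
    treated as a torus, so that shifts commute without side conditions. *)
Definition up (d : T) (q : V) : V :=
  [ffun i => if i == d then inord (q i).+1 else q i].
Definition down (d : T) (q : V) : V :=
  [ffun i => if i == d then inord (q i).-1 else q i].

Lemma upC d e q : up d (up e q) = up e (up d q).
Proof.
apply/ffunP => i; rewrite !ffunE.
by case: (eqVneq i d) => // ->; case: (eqVneq d e).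
Qed.

(** For [ls] = l1, ..., lk and #|D| = k this is the sum, over all orderings
    d1, ..., dk of D, of the products of the increments of [U l1], ..., [U lk]
    along the successive edges of the monotone path from q with steps d1, ..., dk.
    In other words it is the cup product of the coboundaries of the labels,
    summed over the simplices of the Freudenthal triangulation of the unit cube
    at q in the directions D. *)
Fixpoint path_sum (ls : seq T) (D : {set T}) (q : V) : bool :=
  if ls is l :: ls' then
    \sum_(d in D) (U l (up d q) + U l q) * path_sum ls' (D :\ d) (up d q)
  else D == finset.set0.

Lemma setD1C (D : {set T}) d e : D :\ d :\ e = D :\ e :\ d.
Proof. by apply/finset.setP => x; rewrite !inE; do 2!case: eqP. Qed.

Lemma exchange_offdiag (D : {set T}) (F : T -> T -> bool) :
  \sum_(d in D) \sum_(e in D :\ d) F d e = \sum_(e in D) \sum_(d in D :\ e) F d e.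
Proof.
rewrite (exchange_big_dep (mem D)) /=; last by move=> d e _ /setD1P[].
apply: eq_bigr => e eD; apply: eq_bigl => d.
by rewrite !inE eD andbT eq_sym andbC.
Qed.

(** A product of coboundaries is closed: its sum over the boundary of a unit cube
    vanishes.  The contributions symmetric in two consecutive directions cancel
    in pairs; what is left is the same statement for one label fewer. *)
Lemma path_sum_shift ls D q :
  \sum_(d in D) path_sum ls (D :\ d) (up d q) =
  \sum_(d in D) path_sum ls (D :\ d) q.
Proof.
elim: ls D q => [|l ls IH] D q //=.
set P := path_sum ls in IH *.
have IHe e : \sum_(d in D :\ e) P (D :\ e :\ d) (up d (up e q)) =
             \sum_(d in D :\ e) P (D :\ e :\ d) (up e q) by apply: IH.
have sym0 (F : T -> T -> bool) : (forall d e, F d e = F e d) ->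
    \sum_(d in D) \sum_(e in D :\ d) F d e = 0 by apply: sum_symmetric_offdiag.
have symP d e : P (D :\ d :\ e) (up e (up d q)) =
                P (D :\ e :\ d) (up d (up e q)) by rewrite setD1C upC.
under eq_bigr do (under eq_bigr do rewrite mulrDl; rewrite big_split).
under [RHS]eq_bigr do (under eq_bigr do rewrite mulrDl; rewrite big_split).
rewrite !big_split /= sym0 ?add0r; last by move=> d e; rewrite upC setD1C.
rewrite [X in _ = _ + X](_ : _ = 0) ?addr0.
  rewrite exchange_offdiag [RHS]exchange_offdiag.
  rewrite [LHS](_ : _ = \sum_(d in D) U l (up d q) *
     \sum_(e in D :\ d) P (D :\ d :\ e) (up e (up d q))); last first.
    rewrite exchange_offdiag; apply: eq_bigr => d _; rewrite mulr_sumr.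
    by apply: eq_bigr => e _; rewrite upC setD1C.
  apply: eq_bigr => d _; rewrite IHe mulr_sumr.
  by apply: eq_bigr => e _; rewrite setD1C.
rewrite exchange_offdiag.
rewrite (_ : \sum_(e in D) _ = U l q * \sum_(e in D) \sum_(d in D :\ e) P (D :\ e :\ d) (up d (up e q))).
  by rewrite sym0 ?mulr0.
rewrite mulr_sumr; apply: eq_bigr => e _; rewrite IHe mulr_sumr.
by apply: eq_bigr => d _; rewrite setD1C.
Qed.

(** The Stokes formula on one unit cube: since the product over [ls] is closed,
    the full product is the coboundary of [U l] times the product over [ls]. *)
Lemma path_sum_stokes l ls D q :
  path_sum (l :: ls) D q =
  \sum_(d in D) (U l (up d q) * path_sum ls (D :\ d) (up d q)
                 + U l q * path_sum ls (D :\ d) q).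
Proof.
rewrite /=; under eq_bigr do rewrite mulrDl.
by rewrite !big_split /= -!mulr_sumr path_sum_shift.
Qed.

(** On a face orthogonal to l where [U l] is constant, one factor of every
    product vanishes. *)
Lemma path_sum_flat l ls D q : l \in ls -> l \notin D ->
  (forall q' : V, q' l = q l -> U l q' = U l q) -> path_sum ls D q = 0.
Proof.
elim: ls D q => [//|l' ls IH] D q /=; rewrite in_cons => lls lD flat.
apply: big1 => d dD.
have dl : up d q l = q l by rewrite ffunE; case: eqP => // E; rewrite E dD in lD.
have [ll'|l'l] := eqVneq l l'.
  by rewrite -ll' (flat _ dl); case: (U l q); rewrite /= ?mul0r.
rewrite IH ?mulr0 //.
- by move: lls; rewrite (negPf l'l).
- by rewrite !inE (negPf lD) andbF.
- by move=> q' q'l; rewrite (flat _ dl) flat // q'l dl.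
Qed.

(** The directions outside D are those already used up by the induction on the
    dimension, where only the face at height p survives. *)
Definition cube (D : {set T}) (q : V) : bool :=
  [forall i, if i \in D then (q i < p)%N else q i == ord_max].

Definition bottom_face (D : {set T}) (d : T) (q : V) : bool :=
  [forall i, if i == d then q i == ord0 else
     if i \in D then (q i < p)%N else q i == ord_max].

(** Summed over the cells of [cube D], the coboundary in direction d leaves only the
    values on the two opposite faces orthogonal to d; the face at height p is
    [cube (D :\ d)]. *)
Lemma telescope D d (g : V -> bool) : d \in D ->
  \sum_(q | cube D q) (g (up d q) + g q) =
  \sum_(q | cube (D :\ d) q) g q + \sum_(q | bottom_face D d q) g q.
Proof.
move=> dD; rewrite big_split /=.
pose up_cube (q : V) := [forall i, if i == d then (0 < q i)%N else
     if i \in D then (q i < p)%N else q i == ord_max].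
have -> : \sum_(q | cube D q) g (up d q) = \sum_(q | up_cube q) g q.
  rewrite [RHS](reindex_onto (up d) (down d)) /=; last first.
    move=> q /forallP/(_ d); rewrite eqxx => qd; apply/ffunP => i; rewrite !ffunE.
    case: eqP => // ->; apply: val_inj; rewrite /= !inordK ?prednK //.
      exact/ltnW/ltn_ord.
    exact/ltnW/ltn_ord.
  apply: eq_bigl => q; apply/idP/andP => [/forallP bq|[/forallP ubq /eqP dq]].
    have qd : (q d < p)%N by move: (bq d); rewrite dD.
    split; [apply/forallP => i|apply/eqP/ffunP => i]; rewrite !ffunE; case: eqP => // E.
    - by rewrite E inordK.
    - by rewrite E; apply: val_inj; rewrite /= !inordK //= ?ltnS ltnW // ltnS.
  apply/forallP => i; move: (ubq i); rewrite ffunE; case: eqP => // ->; rewrite dD => _.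
  have := ltn_ord (q d); rewrite ltnS leq_eqVlt => /orP[/eqP qp|//].
  move/ffunP: dq => /(_ d); rewrite !ffunE eqxx => /(congr1 val) /=.
  have -> : (inord (q d).+1 : 'I_p.+1) = ord0.
    by apply: val_inj; rewrite /= /inord /insubd insubF //= qp ltnn.
  by rewrite /= inordK // => <-.
pose mid (q : V) := [forall i, if i == d then (0 < q i < p)%N else
     if i \in D then (q i < p)%N else q i == ord_max].
have split3 (P B C : pred V) :
   (forall q, P q = B q || C q) -> (forall q, ~~ (B q && C q)) ->
   \sum_(q | P q) g q = \sum_(q | B q) g q + \sum_(q | C q) g q.
  move=> PBC dis; rewrite (bigID B) /=; congr (_ + _); apply: eq_bigl => q;
  by rewrite PBC; move: (dis q); case: (B q); case: (C q).
rewrite (split3 up_cube (cube (D :\ d)) mid); last 2 first.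
- move=> q; apply/forallP/orP => [ub|[/forallP bq|/forallP mq] i].
  + have := ub d; rewrite eqxx => q0.
    have := ltn_ord (q d); rewrite ltnS leq_eqVlt => /orP[/eqP qp|qp].
      left; apply/forallP => i; move: (ub i); rewrite !inE; case: (i =P d) => [-> _|//] /=.
      by apply/eqP/val_inj.
    right; apply/forallP => i; move: (ub i); case: (i =P d) => // -> _.
    by rewrite q0 qp.
  + by have := bq i; rewrite !inE; case: (i =P d) => [_ /eqP -> //|].
  + by have := mq i; case: (i =P d) => // _ /andP[].
- move=> q; apply/negP => /andP[/forallP/(_ d) + /forallP/(_ d)].
  by rewrite !inE eqxx /= => /eqP -> /=; rewrite ltnn andbF.
rewrite (split3 (cube D) (bottom_face D d) mid); last 2 first.
- move=> q; apply/forallP/orP => [bq|[/forallP fq|/forallP mq] i].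
  + have := bq d; rewrite dD => qp.
    have [q0|q0] := posnP (q d).
      left; apply/forallP => i; move: (bq i); case: (i =P d) => // -> _.
      by apply/eqP/val_inj.
    right; apply/forallP => i; move: (bq i); case: (i =P d) => // -> _.
    by rewrite q0 qp.
  + by have := fq i; case: (i =P d) => // -> /eqP ->; rewrite dD.
  + by have := mq i; case: (i =P d) => // -> /andP[_ ->]; rewrite dD.
- move=> q; apply/negP => /andP[/forallP/(_ d) + /forallP/(_ d)].
  by rewrite eqxx => /eqP -> /=.
set a := \sum_(q | cube _ q) _; set b := \sum_(q | mid q) _; set c := \sum_(q | bottom_face _ _ q) _.
by case: a b c => [] [] [].
Qed.

Hypothesis U_low : forall d q, q d = ord0 -> U d q = false.
Hypothesis U_high : forall d q, q d = ord_max -> U d q = true.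

(** Induction on the dimension.  After summing the Stokes formula over the grid,
    the faces orthogonal to a direction other than l contribute nothing by
    [path_sum_flat], the face at height 0 in direction l contributes nothing
    because [U l] is 0 there, and on the face at height p the factor [U l] is 1,
    which leaves the same sum one dimension lower. *)
Lemma sum_path_sum ls : uniq ls ->
  \sum_(q | cube [set x in ls] q) path_sum ls [set x in ls] q = 1.
Proof.
elim: ls => [_|l ls IH]; last rewrite cons_uniq => /andP[lls /IH{}IH].
  have -> : [set x in [::]] = finset.set0 :> {set T}.
    by apply/finset.setP => x; rewrite !inE.
  rewrite (big_pred1 [ffun => ord_max]) /= ?eqxx // => q.
  apply/forallP/eqP => [bq|-> i]; last by rewrite inE ffunE.
  by apply/ffunP => i; have := bq i; rewrite inE ffunE => /eqP.
set D := [set x in l :: ls].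
under eq_bigr do rewrite path_sum_stokes.
rewrite exchange_big /=.
have lD : l \in D by rewrite !inE eqxx.
have DlE : D :\ l = [set x in ls].
  by apply/finset.setP => i; rewrite !inE; case: eqP => //= ->; rewrite (negPf lls).
under eq_bigr => d dD do
  rewrite (telescope (fun q => U l q * path_sum ls (D :\ d) q) dD).
rewrite (bigD1 l lD) /= DlE [X in _ + X]big1 ?addr0.
  rewrite [X in _ + X]big1 ?addr0.
    rewrite -[RHS]IH; apply: eq_bigr => q /forallP/(_ l).
    by rewrite inE (negPf lls) => /eqP/U_high ->; rewrite mul1r.
  by move=> q /forallP/(_ l); rewrite eqxx => /eqP/U_low ->; rewrite mul0r.
move=> d /andP[dD dl]; have {}dD : d \in D by [].
have dls : d \in ls by move: dD; rewrite /D !inE (negPf dl).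
have dDd : d \notin D :\ d by rewrite !inE eqxx.
rewrite !big1 ?addr0 // => q /forallP/(_ d).
  rewrite eqxx => /eqP q0; rewrite (path_sum_flat dls dDd) ?mulr0 //.
  by move=> q' ?; rewrite !U_low // -q0.
rewrite (negPf dDd) => /eqP q0; rewrite (path_sum_flat dls dDd) ?mulr0 //.
by move=> q' ?; rewrite !U_high // -q0.
Qed.

Definition reach (D : {set T}) (q v : V) :=
  forall i, v i = q i \/ i \in D /\ v i = inord (q i).+1.

Lemma path_sum_neq0 ls D q : path_sum ls D q != 0 ->
  forall l, l \in ls -> exists v w, [/\ reach D q v, reach D q w & U l v != U l w].
Proof.
elim: ls D q => [//|l ls IH] D q /= nz.
have {nz}[d dD] : exists2 d, d \in D &
    (U l (up d q) + U l q) * path_sum ls (D :\ d) (up d q) != 0.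
  apply/exists_inP; apply: contraNT nz => /exists_inPn nz.
  by apply/eqP/big1 => d /nz/negPn/eqP.
rewrite mulf_eq0 negb_or => /andP[Ul nz] l0.
rewrite in_cons => /predU1P[->|/(IH _ _ nz)[v [w [rv rw vw]]]].
  exists (up d q), q; split => //.
  - by move=> i; rewrite ffunE; case: eqP => [->|]; [right|left].
  - by move=> i; left.
  - by apply: contra Ul => /eqP ->; case: (U l q).
have rd v' : reach (D :\ d) (up d q) v' -> reach D q v'.
  move=> rv' i; case: (rv' i); rewrite ffunE.
    by case: eqP => [-> ->|_ ->]; [right|left].
  by rewrite !inE => -[/andP[/negPf -> iD] ->]; right.
by exists v, w; split => //; apply: rd.
Qed.

(** The sum of [sum_path_sum] is nonzero, hence so is the sum at some q, hence
    so is one product: along the corresponding path every label changes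
    on some edge. *)
Theorem kuhn_lemma : exists q : V, (forall i, (q i < p)%N) /\
  forall l, exists v w : V, [/\ forall i, (q i <= v i <= (q i).+1)%N,
     forall i, (q i <= w i <= (q i).+1)%N & U l v != U l w].
Proof.
have [q bq nz] : exists2 q, cube [set x in enum T] q &
    path_sum (enum T) [set x in enum T] q != 0.
  apply/exists_inP; apply: contraT => /exists_inPn nz.
  have := sum_path_sum (enum_uniq T); rewrite big1 // => q bq.
  by move: (nz q bq) => /negPn/eqP.
have qp i : (q i < p)%N by move/forallP: bq => /(_ i); rewrite inE mem_enum.
exists q; split=> // l.
have [v [w [rv rw vw]]] := path_sum_neq0 nz (mem_enum T l).
have rb v' : reach [set x in enum T] q v' -> forall i, (q i <= v' i <= (q i).+1)%N.
  by move=> r i; case: (r i) => [->|[_ ->]]; rewrite ?inordK ?leqnn ?leqnSn ?ltnS.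
by exists v, w; split=> //; apply: rb.
Qed.

End Kuhn.

(** * Approximate fixed points on cubes *)

Lemma exists_invS (R : realType) (e : R) : 0 < e -> exists n : nat, (n.+1%:R)^-1 <= e.
Proof.
move=> e0; exists (Num.truncn e^-1); rewrite invf_ple ?posrE ?ltr0Sn //.
by rewrite ltW // truncnS_gt.
Qed.

(** Label a grid point x in direction i by whether H moves it down in that
    direction.  The cell given by Kuhn's lemma has, for every i, a vertex where
    H does not increase the i-th coordinate and one where it does not decrease
    it, so H nearly fixes each coordinate on a sufficiently small cell. *)
Lemma approx_brouwer (R : realType) (T : finType) (H : (T -> R) -> T -> R) :
  (forall x : T -> R, (forall i, 0 <= x i <= 1) -> forall i, 0 <= H x i <= 1) ->
  (forall e : R, 0 < e -> exists2 d : R, 0 < d & forall x y : T -> R,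
     (forall i, 0 <= x i <= 1) -> (forall i, 0 <= y i <= 1) ->
     (forall i, `|x i - y i| <= d) -> forall i, `|H x i - H y i| <= e) ->
  forall e : R, 0 < e -> exists2 x : T -> R, (forall i, 0 <= x i <= 1) &
     forall i, `|H x i - x i| <= e.
Proof.
move=> H01 Hu e e0.
have [d d0 Hd] := Hu (e / 2) ltac:(lra).
have [k kd] : exists n : nat, (n.+1%:R)^-1 <= Num.min d (e / 2).
  by apply: exists_invS; rewrite lt_min d0 divr_gt0.
have {kd} [kd ke] : (k.+1%:R)^-1 <= d /\ (k.+1%:R)^-1 <= e / 2.
  by move: kd; rewrite le_min => /andP.
set p := k.+1 in kd ke.
pose x (q : {ffun T -> 'I_p.+1}) i : R := (q i)%:R / p%:R.
have p0 : 0 < p%:R :> R by rewrite ltr0Sn.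
have x01 q i : 0 <= x q i <= 1.
  by rewrite divr_ge0 //= ler_pdivrMr // mul1r ler_nat -ltnS.
(* The first disjunct gives the top face its label where H fixes x i = 1. *)
pose U (i : T) (q : {ffun T -> 'I_p.+1}) := (q i == ord_max) || (H (x q) i < x q i).
have [|i q q0|i q qp|q [qp Uq]] := @kuhn_lemma T p _ U; first by [].
- rewrite /U q0 /= ltNge; case/andP: (H01 _ (x01 q) i) => + _.
  by rewrite {2}/x q0 mul0r => ->.
- by rewrite /U qp eqxx.
have close (v : {ffun T -> 'I_p.+1}) : (forall i, (q i <= v i <= (q i).+1)%N) ->
    forall i, `|x v i - x q i| <= p%:R^-1.
  move=> qv i; rewrite /x -mulrBl normrM [X in _ * X]gtr0_norm ?invr_gt0 //.
  rewrite ler_piMl ?invr_ge0 ?ler0n // ler_norml.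
  have /andP[] := qv i; rewrite -!(ler_nat R) -natr1; lra.
exists (x q) => // l.
have [v [w [qv qw vw]]] := Uq l.
wlog Uv : v w qv qw vw / U l v.
  move=> wl; case Uv: (U l v); first exact: (wl v w).
  by apply: (wl w v) => //; [rewrite eq_sym|move: vw; rewrite Uv; case: (U l w)].
have {vw} Uw : ~~ U l w by move: vw; rewrite Uv; case: (U l w).
have near (v' : {ffun T -> 'I_p.+1}) : (forall i, (q i <= v' i <= (q i).+1)%N) ->
    `|x v' l - x q l| <= e / 2 /\ `|H (x v') l - H (x q) l| <= e / 2.
  move=> /close cv; split; first exact: le_trans (cv l) ke.
  by apply: Hd => // i; apply: le_trans (cv i) kd.
have [v1 v2] := near _ qv; have [w1 w2] := near _ qw.
have Hv : H (x v) l <= x v l.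
  case/orP: Uv => [/eqP vp|/ltW //].
  by rewrite {2}/x vp divff ?gt_eqF //; case/andP: (H01 _ (x01 v) l).
have Hw : x w l <= H (x w) l by move: Uw; rewrite negb_or -leNgt => /andP[].
move: v1 v2 w1 w2; rewrite !ler_norml; lra.
Qed.

(** * Uniform continuity and Riemann sums *)

Section Continuity.
Context {R : realType}.

Lemma heine_cantor (V : pseudoMetricType R) (K : set V) (g : V -> R) :
  compact K -> {within K, continuous g} ->
  forall e : R, 0 < e -> exists2 d : R, 0 < d &
    forall x y, K x -> K y -> ball x d y -> `|g x - g y| <= e.
Proof.
move=> /compact_near_coveringP cK /subspace_continuousP cg e e0.
pose P (d : R) x := K x -> forall y, K y -> ball x d y -> `|g x - g y| <= e.
have : \forall d \near 0^'+, K `<=` P d.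
  apply: cK => x Kx.
  have /cvgrPdist_lt/(_ (e / 2) ltac:(lra)) := cg x Kx.
  rewrite near_withinE => /nbhs_ballP[d /= d0 dP].
  exists (ball x (d / 2), [set d' | d' < d / 2]); first split => /=.
  - by apply/nbhsx_ballx; lra.
  - by apply: nbhs_right_lt; lra.
  move=> [x' d'] /= [xx' d'd] Kx' y Ky x'y.
  have h1 : `|g x - g x'| < e / 2.
    by apply: dP => //; apply: le_ball xx'; lra.
  have h2 : `|g x - g y| < e / 2.
    apply: dP => //; rewrite [d](splitr d); apply: ball_triangle xx' _.
    by apply: le_ball x'y; apply: ltW.
  by move: h1 h2; rewrite ler_norml !ltr_norml; lra.
move=> /(filterI (nbhs_right_gt 0)) /filter_ex [d [/= d0 dP]].
by exists d => // x y Kx; apply: dP.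
Qed.

(** By compactness this is continuity on the unit interval; the quantitative form
    is the one that passes through sums, products and limits. *)
Definition ucont (u : R -> R) := forall e : R, 0 < e ->
  exists2 d : R, 0 < d & forall t t', I01 t -> I01 t' ->
    `|t - t'| <= d -> `|u t - u t'| <= e.

Lemma I01P (t : R) : I01 t <-> 0 <= t <= 1.
Proof. by rewrite /I01 /= in_itv. Qed.

Lemma compact_I01 : compact (@I01 R).
Proof. exact: segment_compact. Qed.

Lemma ucontP u : {within I01, continuous u} <-> ucont u.
Proof.
split=> [cu e e0|uc].
  have [d d0 dP] := heine_cantor compact_I01 cu e0.
  exists (d / 2); first lra.
  move=> t t' It It' tt'; apply: dP => //.
  by rewrite /ball /=; lra.
apply/subspace_continuousP => t It; apply/cvgrPdist_le => e e0.
have [d d0 dP] := uc e e0.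
rewrite near_withinE; apply/nbhs_ballP; exists d => //= t' /ltW tt' It'.
exact: dP.
Qed.

Lemma kernel_ucont (g : R -> R -> R) :
  {within I01 `*` I01, continuous (fun p : R * R => g p.1 p.2)} ->
  forall e : R, 0 < e -> exists2 d : R, 0 < d & forall t t' s s',
    I01 t -> I01 t' -> I01 s -> I01 s' -> `|t - t'| <= d -> `|s - s'| <= d ->
    `|g t s - g t' s'| <= e.
Proof.
move=> cg e e0.
have [d d0 dP] := heine_cantor (compact_setX compact_I01 compact_I01) cg e0.
exists (d / 2); first lra.
move=> t t' s s' It It' Is Is' tt' ss'.
apply: (dP (t, s) (t', s')) => //; split => /=; rewrite /ball /=; lra.
Qed.

Lemma ucont_bounded u : ucont u -> exists2 M, 0 < M & forall t, I01 t -> `|u t| <= M.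
Proof.
move=> /ucontP cu.
have [c cI cm] := @EVT_max R (fun x => `|u x|) 0 1 ler01 ltac:(
  by move=> x; apply: continuous_comp; [exact: cu|exact: norm_continuous]).
exists (`|u c| + 1); first by rewrite ltr_pwDr.
by move=> t It; rewrite (le_trans (cm t It)) // lerDl.
Qed.

Lemma ucont_cst (k : R) : ucont (fun=> k).
Proof. by move=> e e0; exists 1 => // *; rewrite subrr normr0 ltW. Qed.

Lemma ucont_mul (u v : R -> R) : ucont u -> ucont v -> ucont (fun t => u t * v t).
Proof.
move=> uu uv e e0.
have [M M0 uM] := ucont_bounded uu; have [N N0 vN] := ucont_bounded uv.
have [d d0 ud] := uu (e / (2 * N)) ltac:(by rewrite divr_gt0 ?mulr_gt0).
have [d' d'0 vd] := uv (e / (2 * M)) ltac:(by rewrite divr_gt0 ?mulr_gt0).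
exists (Num.min d d'); first by rewrite lt_min d0.
move=> t t' It It'; rewrite le_min => /andP[/(ud _ _ It It') h1 /(vd _ _ It It') h2].
rewrite (_ : _ - _ = (u t - u t') * v t + u t' * (v t - v t')); last by ring.
apply: le_trans (ler_normD _ _) _; rewrite !normrM.
have a1 : `|u t - u t'| * `|v t| <= e / (2 * N) * N by rewrite ler_pM // vN.
have a2 : `|u t'| * `|v t - v t'| <= M * (e / (2 * M)) by rewrite ler_pM // uM.
have E1 : e / (2 * N) * N = e / 2 by field; lra.
have E2 : M * (e / (2 * M)) = e / 2 by field; lra.
by rewrite E1 in a1; rewrite E2 in a2; lra.
Qed.

Lemma ucont_scale (k : R) u : ucont u -> ucont (fun t => k * u t).
Proof. exact: ucont_mul (ucont_cst k). Qed.
Let mu := @lebesgue_measure R.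

Lemma measurable_I01 : measurable (@I01 R).
Proof. exact: measurable_itv. Qed.

Lemma ucont_integrable u (A : set R) : ucont u -> measurable A -> A `<=` I01 ->
  mu.-integrable A (EFin \o u).
Proof.
move=> /ucontP cu mA AI; apply: (@integrableS _ _ _ mu (@I01 R) A) => //.
  exact: measurable_I01.
exact: continuous_compact_integrable compact_I01 cu.
Qed.

(** By induction on the number of cells: on each cell the integral lies between
    (phi a - e) h and (phi a + e) h, where a is the left end point. *)
Lemma riemann_bound (phi : R -> R) (e : R) (n : nat) : ucont phi ->
  (forall s s', I01 s -> I01 s' -> `|s - s'| <= n.+1%:R^-1 ->
     `|phi s - phi s'| <= e) ->
  `|n.+1%:R^-1 * \sum_(k < n.+1) phi (k%:R / n.+1%:R)
    - \int[mu]_(s in I01) phi s| <= e.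
Proof.
move=> ucphi osc.
set N := n.+1 in osc *; set h := N%:R^-1 in osc *.
have N0 : 0 < N%:R :> R by rewrite ltr0Sn.
have h0 : 0 < h by rewrite invr_gt0.
have grid k : (k <= N)%N -> I01 (k%:R * h).
  by move=> kN; apply/I01P; rewrite mulr_ge0 ?ler0n ?(ltW h0) //= /h ler_pdivrMr // mul1r ler_nat.
have step m : (m <= N)%N ->
    `|h * \sum_(k < m) phi (k%:R * h)
      - \int[mu]_(s in `[0, (m%:R * h)]) phi s| <= e * (m%:R * h).
  elim: m => [_|m IH mN].
    by rewrite big_ord0 mulr0 mul0r mulr0 set_itv1 Rintegral_set1 subrr normr0.
  set a := m%:R * h; set b := m.+1%:R * h.
  have ab : b = a + h by rewrite /a /b -natr1 mulrDl mul1r.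
  have Ia : I01 a by apply: grid; rewrite ltnW.
  have Ib : I01 b by apply: grid.
  have a0 : 0 <= a by move/I01P: Ia => /andP[].
  have b1 : b <= 1 by move/I01P: Ib => /andP[].
  have sub : `]a, b] `<=` I01.
    by move=> s /=; rewrite in_itv /= => /andP[as_ sb]; apply/I01P; lra.
  have iab : mu.-integrable `]a, b] (EFin \o phi) by apply: ucont_integrable.
  have icst (c : R) : mu.-integrable `]a, b] (EFin \o cst c).
    exact: ucont_integrable (ucont_cst c) _ _.
  have muab : fine (mu `]a, b]%classic) = h.
    by rewrite /mu lebesgue_measure_itv /= lte_fin ifT ?ab /=; lra.
  have := @Rintegral_itvB R phi (BLeft 0) (BRight b) a.
  move=> /(_ _ _ _)/eqP; rewrite subr_eq => /(_ _ _ _)/eqP -> //; first last.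
  - by rewrite bnd_simp ab; lra.
  - apply: ucont_integrable => // s /=; rewrite in_itv /= => /andP[as_ sb].
    by apply/I01P; lra.
  have up : \int[mu]_(s in `]a, b]) phi s <= (phi a + e) * h.
    rewrite -muab -Rintegral_cst //; apply: le_Rintegral => //; first exact: icst.
    move=> s /[dup] /sub Is /=; rewrite in_itv /= => /andP[as_ sb].
    have : `|s - a| <= h by rewrite ger0_norm; lra.
    by move=> /(osc s a Is Ia); rewrite ler_norml; lra.
  have lo : (phi a - e) * h <= \int[mu]_(s in `]a, b]) phi s.
    rewrite -muab -Rintegral_cst //; apply: le_Rintegral => //; first exact: icst.
    move=> s /[dup] /sub Is /=; rewrite in_itv /= => /andP[as_ sb].
    have : `|s - a| <= h by rewrite ger0_norm; lra.
    by move=> /(osc s a Is Ia); rewrite ler_norml; lra.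
  have eb : e * b = e * a + e * h by rewrite ab mulrDr.
  have := IH (ltnW mN); rewrite big_ord_recr /= -/a -/mu !ler_norml eb.
  by move: up lo; rewrite !mulrDr !mulrDl ?mulNr; lra.
have := step N (leqnn N).
rewrite divff ?gt_eqF // mulr1; exact.
Qed.

End Continuity.

(** * Hammerstein systems with bounded nonlinearity *)

Section Hammerstein.
Context {R : realType}.
Local Notation mu := (@lebesgue_measure R).

(** An ultrafilter turns pointwise boundedness into pointwise convergence at all
    points at once, which replaces the extraction of a diagonal subsequence. *)
Lemma ultra_lim (U : set_system nat) (a : nat -> R) (M : R) : UltraFilter U ->
  (forall n, `|a n| <= M) ->
  exists l : R, forall e : R, 0 < e -> U [set n | `|a n - l| <= e].
Proof.
move=> UU aM.
have [l [_ cl]] : `[- M, M] `&` cluster (a @ U) !=set0.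
  apply: (@segment_compact R (- M) M).
  apply: (@filterS _ U _ setT); last exact: filterT.
  move=> n _ /=.
  by rewrite in_itv /= -ler_norml; exact: aM.
exists l => e e0.
have [//|nU] := in_ultra_setVsetC [set n | `|a n - l| <= e] UU.
have [x [/= lx]] := cl [set y | ~ `|y - l| <= e] _ nU (nbhsx_ballx l e e0).
by rewrite /ball /= distrC => /ltW.
Qed.

Lemma mean_bound n (a : 'I_n.+1 -> R) b : (forall k, `|a k| <= b) ->
  `|n.+1%:R^-1 * \sum_k a k| <= b.
Proof.
move=> ab; rewrite normrM gtr0_norm ?invr_gt0 ?ltr0Sn // mulrC.
rewrite ler_pdivrMr ?ltr0Sn //.
apply: le_trans (ler_norm_sum _ _ _) _.
apply: le_trans (ler_sum _ (fun k _ => ab k)) _.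
by rewrite sumr_const card_ord mulr_natr.
Qed.

Lemma grid_I01 n (k : 'I_n.+1) : I01 (k%:R / n.+1%:R : R).
Proof.
apply/I01P; rewrite divr_ge0 ?ler0n //= ler_pdivrMr ?ltr0Sn // mul1r ler_nat.
exact: ltnW.
Qed.

Lemma grid_near n (t : R) : I01 t ->
  exists k : 'I_n.+2, `|t - k%:R / n.+1%:R| <= n.+1%:R^-1 /\ I01 (k%:R / n.+1%:R : R).
Proof.
move=> /I01P /andP[t0 t1]; have N0 : 0 < n.+1%:R :> R by rewrite ltr0Sn.
have tN : 0 <= t * n.+1%:R by rewrite mulr_ge0 // ltW.
have /andP[k1 k2] := truncn_itv tN; set k := Num.truncn _ in k1 k2.
have kn : (k < n.+2)%N.
  by rewrite ltnS -(ler_nat R) (le_trans k1) // ler_piMl // ltW.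
exists (Ordinal kn); split=> /=.
  rewrite -(@ler_pM2r _ n.+1%:R) // mulVf ?gt_eqF // -[X in _ * X <= _]gtr0_norm //.
  rewrite -normrM mulrBl divfK ?gt_eqF // ger0_norm ?subr_ge0 // lerBlDr.
  by rewrite addrC natr1 ltW.
apply/I01P; rewrite divr_ge0 ?ler0n //= ler_pdivrMr // mul1r.
by rewrite (le_trans k1) // ler_piMl // ltW.
Qed.

Variables (T : finType) (G : T -> R -> R -> R).
Hypothesis cG : forall i, {within I01 `*` I01,
  continuous (fun p : R * R => G i p.1 p.2)}.
Variables (Psi : (T -> R -> R) -> T -> R -> R) (F : R).
Hypothesis F_gt0 : 0 < F.
Let F_neq0 : F != 0. Proof. exact: lt0r_neq0. Qed.
Let uc (z : T -> R -> R) := forall i, ucont (z i).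
Hypothesis Psi_bound : forall z, uc z ->
  forall i s, I01 s -> 0 <= Psi z i s <= F.
Hypothesis Psi_uc : forall z, uc z -> uc (Psi z).
Hypothesis Psi_cont : forall e : R, 0 < e -> exists2 d : R, 0 < d &
  forall z w, uc z -> uc w ->
    (forall i t, I01 t -> `|z i t - w i t| <= d) ->
    forall i s, I01 s -> `|Psi z i s - Psi w i s| <= e.

Lemma kernels_ucont (e : R) : 0 < e -> exists2 d : R, 0 < d & forall i t t' s,
  I01 t -> I01 t' -> I01 s -> `|t - t'| <= d -> `|G i t s - G i t' s| <= e.
Proof.
move=> e0; have /choice[d dP] : forall i, exists d : R, 0 < d /\
    forall t t' s, I01 t -> I01 t' -> I01 s -> `|t - t'| <= d -> `|G i t s - G i t' s| <= e.
  move=> i; have [d d0 dP] := kernel_ucont (@cG i) e0.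
  by exists d; split=> // t t' s *; apply: dP => //; rewrite subrr normr0 ltW.
exists (\big[Num.min/1]_i d i).
  by elim/big_ind: _ => // [x y x0 y0|i _]; [rewrite lt_min x0|case: (dP i)].
move=> i t t' s It It' Is tt'; case: (dP i) => _; apply=> //.
by apply: le_trans tt' _; apply: bigmin_le_cond.
Qed.

Lemma kernels_bounded : exists2 g : R, 0 < g & forall i t s,
  I01 t -> I01 s -> `|G i t s| <= g.
Proof.
have /choice[g gP] : forall i, exists g : R, forall t s, I01 t -> I01 s -> `|G i t s| <= g.
  move=> i; have cI2 := compact_setX (@compact_I01 R) (@compact_I01 R).
  have /compact_bounded[M [_ MP]] := continuous_compact (@cG i) cI2.
  exists (`|M| + 1) => t s It Is; apply: (MP (`|M| + 1)).
    by rewrite (le_lt_trans (ler_norm M)) // ltrDl.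
  by exists (t, s).
exists (1 + \sum_i `|g i|); first by rewrite ltr_pwDl // sumr_ge0.
move=> i t s It Is; apply: le_trans (gP i t s It Is) _.
rewrite (bigD1 i) //= (le_trans (ler_norm _)) // addrCA lerDl.
by rewrite addr_ge0 // sumr_ge0.
Qed.

Lemma kernel_row_ucont i t : I01 t -> ucont (G i t).
Proof.
move=> It e e0; have [d d0 dP] := kernel_ucont (@cG i) e0.
by exists d => // s s' Is Is' ss'; apply: dP => //; rewrite subrr normr0 ltW.
Qed.

(** Replace the integral by its Riemann sum.  The unknowns are then the finitely
    many values h of the nonlinearity at the nodes, which range over the cube
    [0, F]^(T * n.+1), and the approximate Brouwer theorem applies to the map
    that recomputes these values from h. *)
Lemma approximants n : exists (z : T -> R -> R) (h : T -> 'I_n.+1 -> R),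
  [/\ forall i t, z i t = n.+1%:R^-1 * \sum_(k < n.+1) G i t (k%:R / n.+1%:R) * h i k,
      uc z, forall i k, 0 <= h i k <= F &
      forall i k, `|h i k - Psi z i (k%:R / n.+1%:R)| <= n.+1%:R^-1].
Proof.
pose zz (x : T * 'I_n.+1 -> R) i t :=
  n.+1%:R^-1 * \sum_(k < n.+1) G i t (k%:R / n.+1%:R) * (F * x (i, k)).
have [g g0 gP] := kernels_bounded.
have Fx (x : T * 'I_n.+1 -> R) j : 0 <= x j <= 1 -> 0 <= F * x j <= F.
  by move=> /andP[x0 x1]; rewrite mulr_ge0 ?(ltW F_gt0) //= ler_piMr // ltW.
have uczz (x : T * 'I_n.+1 -> R) : (forall j, 0 <= x j <= 1) -> uc (zz x).
  move=> x01 i e e0.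
  have [d d0 dP] := kernels_ucont (divr_gt0 e0 F_gt0).
  exists d => // t t' It It' tt'.
  rewrite /zz -mulrBr -sumrB; apply: mean_bound => k.
  rewrite -mulrBl normrM -(divfK F_neq0 e).
  have /andP[f0 f1] := Fx x (i, k) (x01 _).
  apply: ler_pM => //; last by rewrite ger0_norm.
  exact/dP/tt'/grid_I01.
pose H (x : T * 'I_n.+1 -> R) (j : T * 'I_n.+1) := Psi (zz x) j.1 (j.2%:R / n.+1%:R) / F.
have [|||x x01 Hx] := @approx_brouwer R _ H _ _ (n.+1%:R^-1 / F).
- move=> x x01 [i k]; have /andP[p0 p1] := Psi_bound (uczz x x01) i (grid_I01 k).
  by rewrite divr_ge0 ?(ltW F_gt0) //= ler_pdivrMr // mul1r.
- move=> e e0; have [d d0 dP] := Psi_cont (mulr_gt0 e0 F_gt0).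
  exists (d / (g * F)); first by rewrite divr_gt0 ?mulr_gt0.
  move=> x y x01 y01 xy [i k].
  rewrite /H -mulrBl normrM [X in _ * X]gtr0_norm ?invr_gt0 // ler_pdivrMr //.
  apply: dP; [exact: uczz|exact: uczz| |exact: grid_I01].
  move=> i' t It; rewrite /zz -mulrBr -sumrB; apply: mean_bound => k'.
  rewrite -!mulrBr !normrM (gtr0_norm F_gt0).
  have := xy (i', k'); rewrite ler_pdivlMr ?mulr_gt0 // => xyk.
  apply: le_trans xyk; rewrite mulrA mulrC ler_wpM2l // ler_wpM2r ?(ltW F_gt0) //.
  exact/gP/grid_I01.
- by rewrite divr_gt0.
exists (zz x), (fun i k => F * x (i, k)); split=> //.
- exact: uczz.
- by move=> i k; apply: Fx.
- move=> i k; have := Hx (i, k); rewrite /H /= ler_pdivlMr // => {}Hx.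
  rewrite distrC -[X in _ * X]gtr0_norm // -normrM mulrBl in Hx *.
  by move: Hx; rewrite divfK ?gt_eqF // mulrC.
Qed.

(** A form of the Schauder theorem.  The approximants are uniformly bounded and
    equicontinuous because the kernels are, so their limit along an ultrafilter
    is uniform and continuous; the Riemann sums converge to the integral. *)
Theorem hammerstein_fixed_point : exists2 z : T -> R -> R, uc z &
  forall i t, I01 t -> z i t = \int[mu]_(s in I01) (G i t s * Psi z i s).
Proof.
have [g g0 gP] := kernels_bounded.
have [z zP] := choice approximants.
have ucz n : uc (z n) by have [h []] := zP n.
have zb n i t : I01 t -> `|z n i t| <= g * F.
  move=> It; have [h [-> _ hF _]] := zP n; apply: mean_bound => k.
  have /andP[h0 h1] := hF i k.
  by rewrite normrM (ger0_norm h0) ler_pM //; exact/gP/grid_I01.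
have equi (e : R) : 0 < e -> exists2 d : R, 0 < d & forall n i t t', I01 t -> I01 t' ->
    `|t - t'| <= d -> `|z n i t - z n i t'| <= e.
  move=> e0; have [d d0 dP] := kernels_ucont (divr_gt0 e0 F_gt0).
  exists d => // n i t t' It It' tt'.
  have [h [zE _ hF _]] := zP n.
  rewrite !zE -mulrBr -sumrB; apply: mean_bound => k.
  have /andP[h0 h1] := hF i k.
  rewrite -mulrBl normrM -(divfK F_neq0 e).
  by rewrite (ger0_norm h0) ler_pM //; exact/dP/tt'/grid_I01.
have [U [UU ooU]] := @ultraFilterLemma nat \oo _.
have FU : Filter U by exact: _.
have /choice[w wP] : forall it : T * R, exists l : R, I01 it.2 ->
    forall e : R, 0 < e -> U [set n | `|z n it.1 it.2 - l| <= e].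
  move=> [i t]; have [It|nIt] := pselect (I01 t); last by exists 0.
  have [l lP] := ultra_lim UU (fun n => zb n i t It).
  by exists l.
pose zl i t := w (i, t).
have {wP} zlP i t : I01 t -> forall e : R, 0 < e -> U [set n | `|z n i t - zl i t| <= e].
  exact: (wP (i, t)).
clearbody zl.
have equil (e : R) : 0 < e -> exists2 d : R, 0 < d & (forall n i t t', I01 t -> I01 t' ->
    `|t - t'| <= d -> `|z n i t - z n i t'| <= e) /\ forall i t t',
    I01 t -> I01 t' -> `|t - t'| <= d -> `|zl i t - zl i t'| <= e.
  move=> e0; have e30 : 0 < e / 3 by lra.
  have [d d0 dP] := equi _ e30.
  exists d => //; split=> [n|] i t t' It It' tt'.
    by apply: le_trans (dP n i t t' It It' tt') _; lra.
  have /filter_ex[n [/= h1 h2]] := @filterI _ U FU _ _ (zlP i t It _ e30)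
    (zlP i t' It' _ e30).
  move: (dP n i t t' It It' tt') h1 h2; rewrite !ler_norml; lra.
have uczl : uc zl by move=> i e /equil[d d0 [_ dP]]; exists d => // *; apply: dP.
have unif (e : R) : 0 < e ->
    U [set n | forall i t, I01 t -> `|z n i t - zl i t| <= e].
  move=> e0; have e30 : 0 < e / 3 by lra.
  have [d d0 [dz dzl]] := equil _ e30.
  have [p pd] := exists_invS d0.
  have : U [set n | forall ik : T * 'I_p.+2, I01 (ik.2%:R / p.+1%:R : R) ->
       `|z n ik.1 (ik.2%:R / p.+1%:R) - zl ik.1 (ik.2%:R / p.+1%:R)| <= e / 3].
    apply: filter_forall => -[i k] /=.
    have [Ik|nIk] := pselect (I01 (k%:R / p.+1%:R : R)).
      by apply: filterS (zlP i _ Ik _ e30) => n.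
    by apply: (@filterS _ U _ setT) filterT => n _.
  apply: filterS => n nP i t It.
  have [k [tk Ik]] := grid_near p It.
  have {}tk := le_trans tk pd.
  move: (nP (i, k) Ik) (dz n i t _ It Ik tk) (dzl i t _ It Ik tk) => /=.
  by rewrite !ler_norml; lra.
exists zl => // i t It.
apply/eqP; rewrite -subr_eq0 -normr_le0; apply/ler_addgt0Pl => /= e e0; rewrite addr0.
set e' := e / (2 + 2 * g).
have e'0 : 0 < e' by rewrite divr_gt0 //; lra.
have -> : e = e' * (2 + 2 * g) by rewrite /e' divfK //; apply: lt0r_neq0; lra.
clearbody e'.
have [d d0 dP] := Psi_cont e'0.
have ucphi : ucont (fun s => G i t s * Psi zl i s).
  by apply: ucont_mul; [exact: kernel_row_ucont|exact: Psi_uc].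
have [r r0 rP] := ucphi e' e'0.
have [m1 m1r] := exists_invS r0; have [m2 m2e] := exists_invS e'0.
have : U [set n | (maxn m1 m2 <= n)%N] by apply/ooU/nbhs_infty_ge.
move=> /(@filterI _ U FU _ _ (unif d d0)).
move=> /(@filterI _ U FU _ _ (zlP i t It e' e'0)) /filter_ex.
move=> [n [/= h1 [h2]]]; rewrite geq_max => /andP[m1n m2n].
have le_inv m : (m <= n)%N -> n.+1%:R^-1 <= m.+1%:R^-1 :> R.
  by move=> mn; rewrite lef_pV2 ?posrE ?ltr0Sn // ler_nat.
have h3 := @riemann_bound R (fun s => G i t s * Psi zl i s) e' n ucphi _.
have {}h3 := h3 _.
have {h3} := h3 (fun s s' Is Is' ss' => rP s s' Is Is'
   (le_trans ss' (le_trans (le_inv _ m1n) m1r))).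
have : `|z n i t - n.+1%:R^-1 * \sum_(k < n.+1)
    G i t (k%:R / n.+1%:R) * Psi zl i (k%:R / n.+1%:R)| <= g * (e' + e').
  have [h [-> _ _ hP]] := zP n; rewrite -mulrBr -sumrB; apply: mean_bound => k.
  rewrite -mulrBr normrM ler_pM //; first exact/gP/grid_I01.
  have := dP _ _ (ucz n) uczl h2 i _ (grid_I01 k).
  have := le_trans (hP i k) (le_trans (le_inv _ m2n) m2e).
  rewrite !ler_norml; lra.
have -> : e' * (2 + 2 * g) = 2 * e' + 2 * (g * e') by ring.
have -> : g * (e' + e') = 2 * (g * e') by ring.
move: h1; rewrite !ler_norml; set S := _ * \sum_(_ < _) _; set I := Rintegral _ _ _.
by generalize (g * e') S I => ge S' I'; lra.
Qed.

End Hammerstein.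

(** * Extrema, clipping and integrals of nonnegative functions *)

Section Extrema.
Context {R : realType}.
Implicit Types (A : set R) (u w : R -> R).

Lemma le_maxOn A u M t : (forall x, A x -> u x <= M) -> A t -> u t <= maxOn A u.
Proof.
move=> uM At; apply: ub_le_sup; last by exists t.
by exists M => _ [x Ax <-]; apply: uM.
Qed.

Lemma maxOn_le A u M t : A t -> (forall x, A x -> u x <= M) -> maxOn A u <= M.
Proof.
move=> At uM; apply: ge_sup; first by exists (u t); exists t.
by move=> _ [x Ax <-]; apply: uM.
Qed.

Lemma minOn_le A u m t : (forall x, A x -> m <= u x) -> A t -> minOn A u <= u t.
Proof.
move=> um At; apply: ge_inf; last by exists t.
by exists m => _ [x Ax <-]; apply: um.
Qed.

Lemma le_minOn A u m t : A t -> (forall x, A x -> m <= u x) -> m <= minOn A u.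
Proof.
move=> At um; apply: lb_le_inf; first by exists (u t); exists t.
by move=> _ [x Ax <-]; apply: um.
Qed.

Lemma minOn_lipschitz A u w m t d : A t ->
  (forall x, A x -> m <= u x) -> (forall x, A x -> m <= w x) ->
  (forall x, A x -> `|u x - w x| <= d) -> `|minOn A u - minOn A w| <= d.
Proof.
move=> At um wm uw.
have h1 : minOn A w - d <= minOn A u.
  apply: (le_minOn At) => x Ax; have := minOn_le wm Ax.
  by have := uw x Ax; rewrite ler_norml; lra.
have h2 : minOn A u - d <= minOn A w.
  apply: (le_minOn At) => x Ax; have := minOn_le um Ax.
  by have := uw x Ax; rewrite ler_norml; lra.
by rewrite ler_norml; lra.
Qed.

Definition clip (M x : R) := Num.min M (Num.max 0 x).

Lemma clip_itv M x : 0 <= M -> 0 <= clip M x <= M.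
Proof. by by move=> M0; rewrite /clip; case: (lerP 0 x) => ?; case: (lerP M x) => ?; case: (lerP M 0) => ?; lra. Qed.

Lemma clip_lipschitz M x y : `|clip M x - clip M y| <= `|x - y|.
Proof.
rewrite /clip; case: (lerP 0 x) => ?; case: (lerP 0 y) => ?;
  case: (lerP M x) => ?; case: (lerP M y) => ?; case: (lerP M 0) => ?;
  case: (ger0P (x - y)) => ?; rewrite ?ler_norml; lra.
Qed.

Lemma max0_lipschitz (x y : R) : `|Num.max 0 x - Num.max 0 y| <= `|x - y|.
Proof.
case: (lerP 0 x) => ?; case: (lerP 0 y) => ?;
  case: (ger0P (x - y)) => ?; rewrite ?ler_norml; lra.
Qed.

End Extrema.

Section Integrals.
Context {R : realType}.
Local Notation mu := (@lebesgue_measure R).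

Lemma Rintegral_le_subset (u : R -> R) (A B : set R) : ucont u ->
  measurable A -> measurable B -> A `<=` B -> B `<=` I01 ->
  (forall s, I01 s -> 0 <= u s) ->
  \int[mu]_(s in A) u s <= \int[mu]_(s in B) u s.
Proof.
move=> uu mA mB AB BI u0.
have iB := ucont_integrable uu mB BI.
have iA := ucont_integrable uu mA (subset_trans AB BI).
rewrite /Rintegral fine_le ?integrable_fin_num //.
apply: ge0_subset_integral => //; first exact: measurable_int iB.
by move=> x Bx; rewrite lee_fin; apply/u0/BI.
Qed.

Lemma ge0_Rintegral_eq0 (u : R -> R) (a b : R) : 0 <= a -> a < b -> b <= 1 ->
  ucont u -> (forall s, I01 s -> 0 <= u s) ->
  \int[mu]_(s in `[a, b]) u s = 0 -> forall s, a <= s <= b -> u s = 0.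
Proof.
move=> a0 ab b1 uu u0 int0 s sab.
have ab01 x : a <= x <= b -> I01 x by move=> xab; apply/I01P; lra.
apply/eqP; apply: contraT => us.
have {}us : 0 < u s by rewrite lt0r us u0 //; apply: ab01.
have [d d0 dP] := uu (u s / 2) ltac:(lra).
set l := Num.max a (s - d); set r := Num.min b (s + d).
have [al ls sl] : [/\ a <= l, l <= s & s - d <= l].
  by rewrite /l; case: (lerP a (s - d)) => ?; split; lra.
have [rb sr rs] : [/\ r <= b, s <= r & r <= s + d].
  by rewrite /r; case: (lerP b (s + d)) => ?; split; lra.
have lr : l < r by rewrite /l /r; case: (lerP a (s - d)) => ?; case: (lerP b (s + d)) => ?; lra.
have sub : `[l, r] `<=` `[a, b].
  by move=> x /=; rewrite !in_itv /=; lra.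
have sub1 : `[a, b] `<=` I01.
  by move=> x /=; rewrite in_itv /=; apply: ab01.
have : \int[mu]_(s in `[l, r]) u s <= 0.
  by rewrite -int0; apply: Rintegral_le_subset.
have : (u s / 2) * (r - l) <= \int[mu]_(s in `[l, r]) u s.
  have -> : r - l = fine (mu `[l, r]%classic).
    by rewrite lebesgue_measure_itv /= lte_fin lr.
  rewrite -Rintegral_cst //; apply: le_Rintegral => //.
  - apply: ucont_integrable (ucont_cst (u s / 2)) _ _ => //.
    exact: subset_trans sub sub1.
  - by apply: ucont_integrable => //; apply: subset_trans sub sub1.
  - move=> x xlr; have Ix := sub1 _ (sub _ xlr).
    move: xlr; rewrite /= in_itv /= => xlr.
    have := dP s x (ab01 s sab) Ix; rewrite !ler_norml => /(_ _); lra.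
have : 0 < (u s / 2) * (r - l) by rewrite mulr_gt0 //; lra.
lra.
Qed.

Lemma completed_Rintegral_set1 (a : R) (u : R -> R) :
  \int[completed_lebesgue_measure]_(s in [set a]) u s = 0.
Proof.
rewrite (_ : Rintegral _ _ _ =
    \int[completed_lebesgue_measure]_(s in [set a]) u a); last first.
  by apply: eq_Rintegral => s; rewrite inE => ->.
rewrite Rintegral_cst; last exact: (sub_caratheodory _ (measurable_set1 a)).
rewrite (_ : fine _ = 0) ?mulr0 //.
exact: (congr1 fine (lebesgue_measure_set1 a)).
Qed.

End Integrals.

(** * A priori bounds for the truncated system *)

Section Nonlinearity.
Context {R : realType}.
Variables (f : R -> R -> R -> R) (M : R).
Hypothesis f_cont : {within I01 `*` Rplus `*` Rplus,
  continuous (fun p : R * R * R => f p.1.1 p.1.2 p.2)}.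

Let B : set (R * R * R) := I01 `*` `[0, M] `*` `[0, M].

Let compact_B : compact B.
Proof.
apply: compact_setX; last exact: segment_compact.
by apply: compact_setX; [exact: compact_I01|exact: segment_compact].
Qed.

Let cont_B : {within B, continuous (fun p : R * R * R => f p.1.1 p.1.2 p.2)}.
Proof.
apply: continuous_subspaceW f_cont => -[[s u] v] [[/= Is]].
by rewrite /Rplus /= !in_itv /= => /andP[u0 _] /andP[v0 _]; rewrite u0 v0.
Qed.

Lemma nonlinearity_ucont (e : R) : 0 < e -> exists2 d : R, 0 < d &
  forall s s' u u' v v', I01 s -> I01 s' ->
    0 <= u <= M -> 0 <= u' <= M -> 0 <= v <= M -> 0 <= v' <= M ->
    `|s - s'| <= d -> `|u - u'| <= d -> `|v - v'| <= d ->
    `|f s u v - f s' u' v'| <= e.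
Proof.
move=> e0; have [d d0 dP] := heine_cantor compact_B cont_B e0.
exists (d / 2); first lra.
move=> s s' u u' v v' Is Is' u0 u'0 v0 v'0 ss' uu' vv'.
apply: (dP (s, u, v) (s', u', v')); rewrite /B /= ?in_itv //=.
by do !split => /=; rewrite /ball /=; lra.
Qed.

Lemma nonlinearity_bounded : exists F : R, forall s u v,
  I01 s -> 0 <= u <= M -> 0 <= v <= M -> f s u v <= F.
Proof.
have /compact_bounded[K [_ KP]] := continuous_compact cont_B compact_B.
exists (`|K| + 1) => s u v Is u0 v0; apply: le_trans (ler_norm _) _.
apply: (KP (`|K| + 1)); first by rewrite (le_lt_trans (ler_norm K)) // ltrDl.
by exists (s, u, v); rewrite // /B /= !in_itv.
Qed.

End Nonlinearity.

Section System.
Context {R : realType}.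
Local Notation mu := (@lebesgue_measure R).
Variables (G : 'I_2 -> R -> R -> R) (f : 'I_2 -> R -> R -> R -> R).
Variables (a b : R) (Phi : 'I_2 -> R -> R) (c r Rr A B : 'I_2 -> R).
Hypotheses (a_ge0 : 0 <= a) (le_ab : a <= b) (b_le1 : b <= 1).
Let J : set R := `[a, b].
Hypothesis G_ge0 : forall j t s, I01 t -> I01 s -> 0 <= G j t s.
Hypothesis G_cont : forall j,
  {within I01 `*` I01, continuous (fun p : R * R => G j p.1 p.2)}.
Hypothesis c_itv : forall j, 0 < c j < 1.
Hypothesis G_bound : forall j, kernel_bound J (G j) (Phi j) (c j).
Hypothesis f_ge0 : forall j s u v, I01 s -> Rplus u -> Rplus v -> 0 <= f j s u v.
Hypothesis f_cont : forall j, {within I01 `*` Rplus `*` Rplus,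
  continuous (fun p : R * R * R => f j p.1.1 p.1.2 p.2)}.
Hypothesis r_gt0 : forall j, 0 < r j.
Hypothesis r_lt : forall j, r j < c j * Rr j.
Hypothesis A_gt0 : forall j, 0 < A j.
Hypothesis B_gt0 : forall j, 0 < B j.
Hypothesis BSAS : forall j, B j * S_ G J j + A j * Sc_ G J j < 1.
Hypothesis M_R_le : forall j s, (I01 `\` J) s -> M_R f Rr j s <= A j * Rr j.
Hypothesis M_rR_le : forall j s, J s -> M_rR f c r Rr j s <= B j * Rr j.
Hypothesis m_rR_gt : forall j s, J s -> D_ G J j * r j < m_rR f c r Rr j s.

Lemma ord2P (j : 'I_2) : j = 0 \/ j = 1.
Proof. by case: j => [[|[|//]] ?]; [left|right]; apply: val_inj. Qed.

Lemma J_I01 : J `<=` I01.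
Proof. by move=> s; rewrite /J /= in_itv /= => sab; apply/I01P; move: a_ge0 b_le1; lra. Qed.

Let Ja : J a. Proof. by rewrite /J /= in_itv /= lexx. Qed.
Let Ia : I01 a. Proof. exact: J_I01. Qed.
Let mJ : measurable (J : set (measurableTypeR R)).
Proof. exact: measurable_itv. Qed.
Let mI : measurable (@I01 R : set (measurableTypeR R)).
Proof. exact: measurable_I01. Qed.
Let mJc : measurable (I01 `\` J : set (measurableTypeR R)).
Proof. exact: measurableD. Qed.
Let IJI : I01 `\` J `<=` I01. Proof. by move=> s []. Qed.

Lemma Rr_gt0 j : 0 < Rr j.
Proof.
have /andP[c0 c1] := c_itv j; have r0 := r_gt0 j; have := r_lt j.
by move=> /(lt_trans r0); rewrite pmulr_rgt0.
Qed.

Lemma r_lt_Rr j : r j < Rr j.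
Proof.
have /andP[c0 c1] := c_itv j; apply: lt_trans (r_lt j) _.
by rewrite gtr_pMl // Rr_gt0.
Qed.

(** Both sides are compared with [Phi j s]; integrated against a nonnegative
    function, this puts the values of the integral operator in the cone. *)
Lemma kernel_harnack j t t' s : J t -> I01 t' -> I01 s ->
  c j * G j t' s <= G j t s.
Proof.
move=> Jt It' Is; have [_ _ _ ub lb] := G_bound j.
have /andP[c0 _] := c_itv j.
by apply: le_trans (lb t s Jt Is); rewrite ler_wpM2l ?(ltW c0) // ub.
Qed.

Lemma row_ucont j t : I01 t -> ucont (G j t).
Proof. exact: kernel_row_ucont. Qed.

Lemma kint_le_maxOn j (E : set R) t : measurable (E : set (measurableTypeR R)) ->
  E `<=` I01 -> I01 t -> kint G j E t <= maxOn I01 (kint G j E).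
Proof.
move=> mE EI It; have [g g0 gP] := kernels_bounded G_cont.
apply: (@le_maxOn _ _ _ g) => // x Ix.
have Gx := row_ucont j Ix.
apply: (@le_trans _ _ (\int[mu]_(s in I01) G j x s)).
  by apply: Rintegral_le_subset => // s; apply: G_ge0.
have muI : fine (mu I01) = 1.
  by rewrite /I01 lebesgue_measure_itv /= lte_fin ltr01 /= subr0.
rewrite -[leRHS]mulr1 -muI -(Rintegral_cst _ mI).
apply: le_Rintegral => //; [exact: ucont_integrable|exact: ucont_integrable (ucont_cst g) _ _|].
by move=> s Is; apply: le_trans (ler_norm _) (gP j x s Ix Is).
Qed.

(** If the integral vanished, the continuous function G(a, .) would vanish on J
    (when J is not a point), hence so would Phi, whose integral is positive. *)
Lemma kint_J_gt0 j : 0 < kint G j J a.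
Proof.
have Ga := row_ucont j Ia.
have G0 s : I01 s -> 0 <= G j a s by apply: G_ge0.
rewrite lt0r Rintegral_ge0 ?andbT; last by move=> s /J_I01/G0.
apply/eqP => int0; have [Phi0 _ + _ lb] := G_bound j.
apply/negP; rewrite -leNgt.
have [ab|ab] := ltP a b; last first.
  by rewrite /J (_ : b = a) ?set_itv1 ?completed_Rintegral_set1 //; apply/le_anti/andP.
rewrite (_ : Rintegral _ _ _ = \int[completed_lebesgue_measure]_(s in J) 0).
  by rewrite /Rintegral integral0.
apply: eq_Rintegral => s; rewrite inE => Js; have Is := J_I01 Js.
have /andP[c0 _] := c_itv j.
apply/le_anti; rewrite Phi0 // andbT -(pmulr_rle0 _ c0).
have Gs : G j a s = 0.
  apply: (ge0_Rintegral_eq0 a_ge0 ab b_le1 Ga G0 int0).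
  by move: Js; rewrite /J /= in_itv.
by rewrite -Gs lb.
Qed.

(** This makes D a genuine reciprocal rather than the inverse of 0. *)
Lemma minOn_kint_gt0 j : 0 < minOn J (kint G j J).
Proof.
have /andP[c0 _] := c_itv j.
apply: lt_le_trans (mulr_gt0 c0 (kint_J_gt0 j)) _; apply: (le_minOn Ja) => t Jt.
have It := J_I01 Jt.
rewrite /kint -RintegralZl //; last exact: ucont_integrable (row_ucont j Ia) mJ J_I01.
apply: le_Rintegral => //; first 2 last.
- by move=> s /J_I01 Is; apply: kernel_harnack.
- apply: (ucont_integrable _ mJ J_I01); exact/ucont_scale/row_ucont.
- exact: ucont_integrable (row_ucont j It) mJ J_I01.
Qed.

(** A retraction onto the functions with r <= z on J and 0 <= z <= Rr.  Lifting by
    a constant, unlike taking the maximum with r on J, keeps the result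
    continuous across the end points of J. *)
Definition truncation (z : 'I_2 -> R -> R) (j : 'I_2) (s : R) : R :=
  clip (Rr j) (z j s + Num.max 0 (r j - minOn J (z j))).

Definition truncated_nonlinearity (z : 'I_2 -> R -> R) (j : 'I_2) (s : R) : R :=
  fval f j s (truncation z ^~ s).

Local Notation Psi := truncated_nonlinearity.
Let M := Rr 0 + Rr 1.

Lemma truncation_itv z j s : 0 <= truncation z j s <= Rr j.
Proof. exact/clip_itv/ltW/Rr_gt0. Qed.

Lemma truncation_M z j s : 0 <= truncation z j s <= M.
Proof.
have /andP[-> h] := truncation_itv z j s; apply: le_trans h _.
have := Rr_gt0 0; have := Rr_gt0 1; rewrite /M.
by case: (ord2P j) => ->; lra.
Qed.

Lemma truncation_ucont z j : ucont (z j) -> ucont (truncation z j).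
Proof.
move=> uz e e0; have [d d0 dP] := uz e e0; exists d => // t t' It It' tt'.
apply: le_trans (clip_lipschitz _ _ _) _.
by rewrite opprD addrACA subrr addr0; apply: dP.
Qed.

Lemma truncated_ucont z : (forall j, ucont (z j)) -> forall j, ucont (Psi z j).
Proof.
move=> uz j e e0; have [d d0 dP] := nonlinearity_ucont M (@f_cont j) e0.
have [d0' d0'0 d0P] := truncation_ucont (uz 0) d0.
have [d1' d1'0 d1P] := truncation_ucont (uz 1) d0.
exists (Num.min d (Num.min d0' d1')); first by rewrite !lt_min d0 d0'0.
move=> t t' It It'; rewrite !le_min => /and3P[h h0 h1].
by apply: dP => //; rewrite ?truncation_M //; [apply: d0P|apply: d1P].
Qed.

Lemma truncation_lipschitz z w d : (forall j, ucont (z j)) -> (forall j, ucont (w j)) ->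
  (forall j t, I01 t -> `|z j t - w j t| <= d) ->
  forall j s, I01 s -> `|truncation z j s - truncation w j s| <= d + d.
Proof.
move=> uz uw zw j s Is; apply: le_trans (clip_lipschitz _ _ _) _.
have [N N0 zN] := ucont_bounded (uz j); have [N' N'0 wN] := ucont_bounded (uw j).
rewrite opprD addrACA; apply: le_trans (ler_normD _ _) _; apply: lerD; first exact: zw.
apply: le_trans (max0_lipschitz _ _) _.
rewrite opprB addrC addrA subrK distrC.
apply: (@minOn_lipschitz _ _ _ _ (- (N + N')) _ _ Ja) => x /J_I01 Ix.
- by have := zN x Ix; rewrite ler_norml; lra.
- by have := wN x Ix; rewrite ler_norml; lra.
- exact: zw.
Qed.

Lemma truncated_cont e : 0 < e -> exists2 d, 0 < d & forall z w,
  (forall j, ucont (z j)) -> (forall j, ucont (w j)) ->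
  (forall j t, I01 t -> `|z j t - w j t| <= d) ->
  forall j s, I01 s -> `|Psi z j s - Psi w j s| <= e.
Proof.
move=> e0.
have [d dP] := choice (fun j => let: ex_intro2 d d0 dP :=
  nonlinearity_ucont M (@f_cont j) e0 in ex_intro (fun d : R => 0 < d /\ _) d (conj d0 dP)).
have d00 : 0 < d 0 by case: (dP 0). have d10 : 0 < d 1 by case: (dP 1).
exists (Num.min (d 0) (d 1) / 2); first by rewrite divr_gt0 // lt_min d00.
move=> z w uz uw zw j s Is; have := truncation_lipschitz uz uw zw.
rewrite -splitr => tzw.
have dj : Num.min (d 0) (d 1) <= d j.
  by case: (ord2P j) => ->; rewrite ge_min lexx ?orbT.
case: (dP j) => _; apply=> //; rewrite ?truncation_M //.
- by rewrite subrr normr0; case: (dP j) => /ltW.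
- by apply: le_trans dj; apply: tzw.
- by apply: le_trans dj; apply: tzw.
Qed.

Lemma truncated_bounded : exists2 F, 0 < F & forall z j s, I01 s -> 0 <= Psi z j s <= F.
Proof.
have [F FP] := choice (fun j => nonlinearity_bounded M (@f_cont j)).
exists (1 + `|F 0| + `|F 1|).
  by rewrite ltr_wpDr // ltr_pwDl.
move=> z j s Is; rewrite f_ge0 //=; last 2 first.
- by rewrite /Rplus /= in_itv /= andbT; case/andP: (truncation_itv z 0 s).
- by rewrite /Rplus /= in_itv /= andbT; case/andP: (truncation_itv z 1 s).
apply: le_trans (FP j s _ _ Is (truncation_M z 0 s) (truncation_M z 1 s)) _.
have h0 := ler_norm (F 0); have h1 := ler_norm (F 1).
have p0 := normr_ge0 (F 0); have p1 := normr_ge0 (F 1).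
by case: (ord2P j) => ->; lra.
Qed.

Let value_box : set ('I_2 -> R) := [set v | forall i, 0 <= v i <= Rr i].

Lemma Rr_le_M j : Rr j <= M.
Proof.
have := Rr_gt0 0; have := Rr_gt0 1; rewrite /M.
by case: (ord2P j) => ->; lra.
Qed.

Lemma fval_le_sup j s (E : set ('I_2 -> R)) v : I01 s -> E `<=` value_box -> E v ->
  fval f j s v <= sup (fval f j s @` E).
Proof.
move=> Is Eb Ev; apply: ub_le_sup; last by exists v.
have [F FP] := nonlinearity_bounded M (@f_cont j).
exists F => _ [w /Eb wb <-]; apply: FP => //.
  by have /andP[-> h] := wb 0; apply: le_trans h (Rr_le_M 0).
by have /andP[-> h] := wb 1; apply: le_trans h (Rr_le_M 1).
Qed.

Lemma inf_le_fval j s (E : set ('I_2 -> R)) v : I01 s -> E `<=` value_box -> E v ->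
  inf (fval f j s @` E) <= fval f j s v.
Proof.
move=> Is Eb Ev; apply: ge_inf; last by exists v.
exists 0 => _ [w /Eb wb <-]; apply: f_ge0 => //.
  by have /andP[h _] := wb 0; rewrite /Rplus /= in_itv /= h.
by have /andP[h _] := wb 1; rewrite /Rplus /= in_itv /= h.
Qed.

Lemma le_M_R j s v : I01 s -> value_box v -> fval f j s v <= M_R f Rr j s.
Proof.
move=> Is vb; apply: fval_le_sup => //.
by move=> w [wj wi] i; have [->//|/wi] := eqVneq i j.
Qed.

Lemma le_M_rR j s v : I01 s -> c j * Rr j <= v j <= Rr j ->
  (forall i, r i <= v i <= Rr i) -> fval f j s v <= M_rR f c r Rr j s.
Proof.
move=> Is vj vi; apply: fval_le_sup => //.
move=> w [/andP[wj wj'] wi] i; have [->|/wi/andP[h ->]] := eqVneq i j.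
  have /andP[c0 _] := c_itv j.
  by rewrite wj' andbT; apply: le_trans wj; rewrite mulr_ge0 ?ltW // Rr_gt0.
by rewrite andbT; apply: le_trans h; rewrite ltW.
Qed.

Lemma m_rR_le j s v : I01 s -> c j * v j <= r j ->
  (forall i, r i <= v i <= Rr i) -> m_rR f c r Rr j s <= fval f j s v.
Proof.
have /andP[c0 _] := c_itv j.
move=> Is vj vi; apply: inf_le_fval => //; last first.
  split; last by move=> i _.
  by have /andP[-> _] := vi j; rewrite /= ler_pdivlMr // mulrC.
move=> w [/andP[wj wj'] wi] i; have [->|/wi/andP[h ->]] := eqVneq i j.
  rewrite (le_trans (ltW (r_gt0 j)) wj) (le_trans wj') //.
  by rewrite ler_pdivrMr // mulrC ltW.
by rewrite andbT; apply: le_trans h; rewrite ltW.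
Qed.

Section FixedPoint.
Variable z : 'I_2 -> R -> R.
Hypothesis z_ucont : forall j, ucont (z j).
Hypothesis z_fixed : forall j t, I01 t ->
  z j t = \int[mu]_(s in I01) (G j t s * Psi z j s).

Lemma integrand_ucont j t : I01 t -> ucont (fun s => G j t s * Psi z j s).
Proof. by move=> It; apply: ucont_mul (row_ucont j It) (truncated_ucont z_ucont j). Qed.

Lemma Psi_ge0 j s : I01 s -> 0 <= Psi z j s.
Proof. by have [F _ FP] := truncated_bounded => /(FP z j)/andP[]. Qed.

Lemma integrand_ge0 j t s : I01 t -> I01 s -> 0 <= G j t s * Psi z j s.
Proof. by move=> It Is; rewrite mulr_ge0 ?G_ge0 ?Psi_ge0. Qed.

Lemma z_ge0 j t : I01 t -> 0 <= z j t.
Proof.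
by move=> It; rewrite z_fixed // Rintegral_ge0 // => s Is; apply: integrand_ge0.
Qed.

Lemma z_harnack j t t' : J t -> I01 t' -> c j * z j t' <= z j t.
Proof.
move=> Jt It'; have It := J_I01 Jt.
have ui := integrand_ucont j It'.
rewrite !z_fixed // -RintegralZl //; last exact: ucont_integrable ui _ _.
apply: le_Rintegral => //.
- apply: (ucont_integrable _ mI) => //; exact: ucont_scale.
- exact: ucont_integrable (integrand_ucont j It) _ _.
- move=> s Is; rewrite mulrA ler_wpM2r ?Psi_ge0 //.
  exact: kernel_harnack.
Qed.

Lemma z_lbound j x : J x -> 0 <= z j x.
Proof. by move=> /J_I01; apply: z_ge0. Qed.

Lemma truncation_ge_r j s : J s -> r j <= truncation z j s.
Proof.
move=> Js; have h := minOn_le (@z_lbound j) Js.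
rewrite /truncation /clip; move: (r_lt_Rr j) (r_gt0 j) h.
set m := minOn _ _; rewrite le_min => /ltW -> r0 h /=; rewrite le_max.
by apply/orP; right; case: (lerP 0 (r j - m)) => h'; lra.
Qed.

Lemma truncation_rR j s : J s -> r j <= truncation z j s <= Rr j.
Proof. by move=> Js; rewrite truncation_ge_r //; case/andP: (truncation_itv z j s). Qed.

(** Suppose z j reaches Rr j.  By the Harnack inequality it is at least
    c j * Rr j on J, so the truncation lies in the ranges over which the maxima
    M are taken; their bounds and B S + A S^c < 1 give z j < Rr j everywhere. *)
Lemma z_lt_Rr j t : I01 t -> z j t < Rr j.
Proof.
move=> It; rewrite ltNge; apply/negP => Rz.
have /andP[c0 c1] := c_itv j; have R0 := Rr_gt0 j.
have big s : J s -> c j * Rr j <= truncation z j s <= Rr j.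
  move=> Js; have /andP[_ ->] := truncation_itv z j s; rewrite andbT.
  have h : c j * Rr j <= z j s.
    by apply: le_trans (z_harnack j Js It); rewrite ler_pM2l.
  rewrite /truncation /clip le_min ler_piMl ?(ltW R0) ?(ltW c1) //= le_max; apply/orP; right.
  by apply: le_trans h _; rewrite lerDl le_max lexx.
have onJ s : J s -> Psi z j s <= B j * Rr j.
  move=> Js; apply: le_trans (M_rR_le j Js); apply: le_M_rR; first exact: J_I01.
    exact: big.
  by move=> i; apply: truncation_rR.
have onJc s : (I01 `\` J) s -> Psi z j s <= A j * Rr j.
  move=> Jcs; apply: le_trans (M_R_le j Jcs); apply: le_M_R; first by case: Jcs.
  by move=> i; apply: truncation_itv.
have part (E : set R) K : measurable (E : set (measurableTypeR R)) -> E `<=` I01 ->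
    0 <= K -> (forall s, E s -> Psi z j s <= K) ->
    \int[mu]_(s in E) (G j t s * Psi z j s) <= K * maxOn I01 (kint G j E).
  move=> mE EI K0 EK.
  apply: (@le_trans _ _ (K * kint G j E t)); last first.
    by rewrite ler_wpM2l // kint_le_maxOn.
  rewrite /kint -RintegralZl //; last exact: ucont_integrable (row_ucont j It) mE EI.
  apply: le_Rintegral => //.
  - exact: ucont_integrable (integrand_ucont j It) mE EI.
  - apply: (ucont_integrable _ mE EI); exact/ucont_scale/row_ucont.
  - by move=> s Es; rewrite mulrC ler_wpM2r ?EK ?G_ge0 //; apply: EI.
have hJ := part J _ mJ J_I01 (mulr_ge0 (ltW (B_gt0 j)) (ltW R0)) onJ.
have hJc := part _ _ mJc IJI (mulr_ge0 (ltW (A_gt0 j)) (ltW R0)) onJc.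
move: Rz; rewrite z_fixed // -{1}(setDUK J_I01) Rintegral_setU //; last 2 first.
- rewrite setDUK; last exact: J_I01.
  exact: ucont_integrable (integrand_ucont j It) _ _.
- by apply/disj_setPS => s [Js []].
apply/negP; rewrite -ltNge; apply: le_lt_trans (lerD hJ hJc) _.
rewrite -/(S_ G J j) -/(Sc_ G J j).
rewrite (_ : _ + _ = (B j * S_ G J j + A j * Sc_ G J j) * Rr j); last by ring.
by rewrite gtr_pMl.
Qed.

(** Suppose min z j <= r j on J.  By the Harnack inequality z j is at most
    (min z j) / c j, so the lifted function lies between r j and r j / c j on J,
    the range of the minimum m; its lower bound D * r then gives z j > r j on J. *)
Lemma r_lt_minOn_z j : r j < minOn J (z j).
Proof.
rewrite ltNge; apply/negP => mr.
have /andP[c0 c1] := c_itv j.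
have small s : J s -> c j * truncation z j s <= r j.
  move=> Js; have Is := J_I01 Js.
  have cz : c j * z j s <= minOn J (z j).
    by apply: (le_minOn Ja) => t Jt; apply: z_harnack.
  apply: (@le_trans _ _ (c j * (z j s + (r j - minOn J (z j))))).
    rewrite ler_wpM2l ?(ltW c0) // /truncation.
    have -> : Num.max 0 (r j - minOn J (z j)) = r j - minOn J (z j).
      by apply/max_idPr; rewrite subr_ge0.
    rewrite /clip ge_min; apply/orP; right; rewrite ge_max lexx andbT.
    by rewrite addr_ge0 ?z_ge0 // subr_ge0.
  have h : 0 <= (1 - c j) * (r j - minOn J (z j)).
    by rewrite mulr_ge0 // subr_ge0 // ltW.
  rewrite mulrDr; move: h; rewrite mulrBl mul1r; lra.
have onJ s : J s -> D_ G J j * r j < Psi z j s.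
  move=> Js; apply: lt_le_trans (m_rR_gt j Js) _.
  apply: m_rR_le (J_I01 Js) (small s Js) _ => i.
  exact: truncation_rR.
(* Strictness survives the integration because the bound is uniform on J. *)
have cPsi : {within `[a, b], continuous (Psi z j)}.
  apply: continuous_subspaceW J_I01 _; apply/ucontP; exact: truncated_ucont.
have [s0 s0J s0min] := EVT_min le_ab cPsi.
have k0 := minOn_kint_gt0 j.
have k_le t : J t -> minOn J (kint G j J) <= kint G j J t.
  apply: (@minOn_le _ _ _ 0) => x Jx; apply: Rintegral_ge0 => s Js.
  by apply: G_ge0; apply: J_I01.
have eta0 : 0 <= Psi z j s0 by apply/Psi_ge0/J_I01.
have : Psi z j s0 * minOn J (kint G j J) <= minOn J (z j).
  apply: (le_minOn Ja) => t Jt; have It := J_I01 Jt.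
  apply: (@le_trans _ _ (Psi z j s0 * kint G j J t)).
    by rewrite ler_wpM2l // k_le.
  rewrite z_fixed //.
  apply: (@le_trans _ _ (\int[mu]_(s in J) (G j t s * Psi z j s))); last first.
    apply: Rintegral_le_subset (integrand_ucont j It) mJ mI J_I01 _ _ => //.
    by move=> s; apply: integrand_ge0.
  rewrite /kint -RintegralZl //; last exact: ucont_integrable (row_ucont j It) mJ J_I01.
  apply: le_Rintegral => //.
  - apply: (ucont_integrable _ mJ J_I01); exact/ucont_scale/row_ucont.
  - exact: ucont_integrable (integrand_ucont j It) mJ J_I01.
  - by move=> s Js; rewrite mulrC ler_wpM2l ?s0min ?G_ge0 //; apply: J_I01.
move=> /le_trans/(_ mr); rewrite -ler_pdivlMr // mulrC.
by rewrite leNgt -/(D_ G J j) onJ.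
Qed.

Lemma truncation_id j s : I01 s -> truncation z j s = z j s.
Proof.
move=> Is; rewrite /truncation.
have -> : Num.max 0 (r j - minOn J (z j)) = 0.
  by apply/max_idPl; rewrite subr_le0 ltW // r_lt_minOn_z.
rewrite addr0 /clip; have -> : Num.max 0 (z j s) = z j s.
  by apply/max_idPr; apply: z_ge0.
by apply/min_idPr/ltW/z_lt_Rr.
Qed.

Lemma z_solves : solves G f z.
Proof.
move=> j t It; rewrite z_fixed //; apply: eq_Rintegral => s; rewrite inE => Is.
by rewrite /truncated_nonlinearity /fval !truncation_id.
Qed.

Lemma normI_z_lt j : normI (z j) < Rr j.
Proof.
have /ucontP cz := z_ucont j.
have [t tI tmax] := EVT_max ler01 cz.
apply: le_lt_trans (z_lt_Rr j tI); apply: (maxOn_le Ia) => x Ix.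
by rewrite ger0_norm ?z_ge0 //; apply: tmax.
Qed.

Lemma z_cone : cone J c z.
Proof.
move=> j; split; [exact/ucontP|exact: z_ge0|move=> t Jt].
have /andP[c0 c1] := c_itv j.
rewrite mulrC -ler_pdivlMr //; apply: (maxOn_le Ia) => x Ix.
by rewrite ger0_norm ?z_ge0 // ler_pdivlMr // mulrC z_harnack.
Qed.

Lemma z_positive : positive_solution G f z.
Proof.
split; last exact: z_solves.
move=> j; split; [exact/ucontP|exact: z_ge0|exists a => //].
rewrite gt_eqF // (lt_trans (r_gt0 j)) // (lt_le_trans (r_lt_minOn_z j)) //.
exact: minOn_le (@z_lbound j) Ja.
Qed.

End FixedPoint.

Lemma localized_solution : exists x : 'I_2 -> R -> R,
  [/\ positive_solution G f x, cone J c x &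
      forall j, r j < minOn J (x j) /\ normI (x j) < Rr j].
Proof.
have [F F0 FP] := truncated_bounded.
have [z uz zE] := hammerstein_fixed_point G_cont F0
  (fun z _ => FP z) truncated_ucont truncated_cont.
exists z; split; [exact: z_positive|exact: z_cone|move=> j].
by split; [exact: r_lt_minOn_z|exact: normI_z_lt].
Qed.

End System.

Theorem theorem5p1 (R : realType) (G : 'I_2 -> R -> R -> R)
    (f : 'I_2 -> R -> R -> R -> R) (J : set R) (Phi : 'I_2 -> R -> R)
    (c r Rr A B : 'I_2 -> R)
    (hJ : closed_subinterval J)
    (hG_ge0 : forall j t s, I01 t -> I01 s -> 0 <= G j t s)
    (hG_cont : forall j, {within I01 `*` I01,
       continuous (fun p : R * R => G j p.1 p.2)})
    (hc : forall j, 0 < c j < 1)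
    (hPhi : forall j, kernel_bound J (G j) (Phi j) (c j))
    (hf_ge0 : forall j s u v, I01 s -> Rplus u -> Rplus v -> 0 <= f j s u v)
    (hf_cont : forall j, {within I01 `*` Rplus `*` Rplus,
       continuous (fun p : R * R * R => f j p.1.1 p.1.2 p.2)})
    (hpos : forall j, [/\ 0 < r j, 0 < Rr j, 0 < A j & 0 < B j])
    (hrR : forall j, r j < c j * Rr j)
    (hBdA : forall j, B j <= d_ G j <= A j)
    (hBSAS : forall j, B j * S_ G J j + A j * Sc_ G J j < 1)
    (hA1 : forall j s, (I01 `\` J) s -> 0 <= M_R f Rr j s <= A j * Rr j)
    (hA2 : forall j s, J s -> 0 <= M_rR f c r Rr j s <= B j * Rr j)
    (hB : forall j s, J s -> m_rR f c r Rr j s > D_ G J j * r j) :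
  exists x : 'I_2 -> R -> R,
    [/\ positive_solution G f x, cone J c x &
        forall j, r j < minOn J (x j) /\ normI (x j) < Rr j].
Proof.
case: hJ => a [b [a0 ab b1 JE]]; subst J.
apply: (@localized_solution _ _ _ _ _ Phi _ _ _ A B) => //.
- by move=> j; case: (hpos j).
- by move=> j; case: (hpos j).
- by move=> j; case: (hpos j).
- by move=> j s /(hA1 j)/andP[].
- by move=> j s /(hA2 j)/andP[].
Qed.
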